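(* Let $C$ be a proper strictly convex cone such that the pair $(C_\square,C)$ has the Lorentz factorization property (LFP). Then $C$ is Lorentzian.
   Context: All vector spaces are real and finite-dimensional. A convex cone $C\subseteq V$ is proper if it is closed, pointed ($C\cap(-C)=\{0\}$) and generating (it spans $V$). A face of $C$ is a convex cone $F\subseteq C$ such that $x\in F$, $y,z\in C$, $x=y+z$ imply $y,z\in F$; an extremal ray is a $1$-dimensional face. A proper cone $C$ is strictly convex if $\mathbb{R}_+x$ is an extremal ray for every nonzero boundary point $x\in\partial C$. The square-based cone is $C_\square=\{(x,y,z)\in\mathbb{R}^3 : |y|+|z|\le x\}$. For $n\ge 1$ the Lorentz cone is $L_n=\{(t,x_1,\dots,x_{n-1})\in\mathbb{R}^n : t\ge (x_1^2+\cdots+x_{n-1}^2)^{1/2}\}$; a cone is Lorentzian if it is linearly isomorphic to some $L_n$. For proper cones $C_1\subseteq V_1$, $C_2\subseteq V_2$, $\mathrm{Pos}(C_1,C_2)$ is the set of linear maps $P:V_1\to V_2$ with $P(C_1)\subseteq C_2$, and $\mathrm{LorFact}(C_1,C_2)=\operatorname{conv}\{\beta\alpha : \alpha\in\mathrm{Pos}(C_1,L),\ \beta\in\mathrm{Pos}(L,C_2),\ L \text{ a Lorentzian cone}\}$. The pair $(C_1,C_2)$ has the Lorentz factorization property (LFP) if $\mathrm{LorFact}(C_1,C_2)=\mathrm{Pos}(C_1,C_2)$. *)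

(* Defs.v *)
(* MathComp and MathComp-Analysis. Real vector spaces of finite dimension are
   [V : vectType R] with [R : realType]; linear maps are ['Hom(V, W)]. *)
From HB Require Import structures.
From mathcomp Require Import all_boot all_order all_algebra.
From mathcomp Require Import all_classical reals topology normedtype convex.

Set Implicit Arguments.
Unset Strict Implicit.
Unset Printing Implicit Defensive.

Import Order.TTheory GRing.Theory Num.Theory.
Import numFieldNormedType.Exports.

Local Open Scope classical_set_scope.
Local Open Scope ring_scope.

Section Topology.
Context {R : realType} {V : vectType R}.
Implicit Types A : set V.

(* A [vectType] carries no topology in the library. All Hausdorff vector space
   topologies on [V] coincide, so the topology of [V] is obtained from that of
   the row vectors by taking coordinates in the basis [vbasis {:V}]. *)
Definition coords A : set 'rV[R]_(\dim {:V}) :=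
  [set u | A (passmx.vecof (vbasis {:V}) u)].

Definition vclosed A : Prop := closed (coords A).

Definition vboundary A : set V :=
  [set x | (closure (coords A) `\` interior (coords A))
             (passmx.rVof (vbasis {:V}) x)].

End Topology.

Section Cones.
Context {R : realType} {V : vectType R}.
Implicit Types (A C F : set V) (x : V).

Definition convex_cone C : Prop :=
  [/\ C 0,
      forall x y, C x -> C y -> C (x + y) &
      forall (t : R) x, 0 <= t -> C x -> C (t *: x)].

Definition linear_span A : set V :=
  [set v | exists2 s : seq V, {in s, forall x, A x} & v \in <<s>>%VS].

Definition proper_cone C : Prop :=
  [/\ convex_cone C,
      vclosed C,
      C `&` [set - x | x in C] = [set 0] &
      linear_span C = [set: V]].

Definition face C F : Prop :=
  [/\ convex_cone F,
      F `<=` C &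
      forall x y z, F x -> C y -> C z -> x = y + z -> F y /\ F z].

(* The dimension of a cone is the dimension of its linear span. *)
Definition extremal_ray C F : Prop :=
  face C F /\ exists2 U : {vspace V}, \dim U = 1%N & linear_span F = [set` U].

Definition ray x : set V := [set t *: x | t in [set t : R | 0 <= t]].

Definition strictly_convex_cone C : Prop :=
  proper_cone C /\
  forall x, vboundary C x -> x != 0 -> extremal_ray C (ray x).

End Cones.

(* The coordinates (x, y, z) are the entries 0, 1, 2 of a row vector. *)
Definition square_cone (R : realType) : set 'rV[R]_3 :=
  [set v : 'rV[R]_3 | `|v 0 1| + `|v 0 2%:R| <= v 0 0].
Arguments square_cone : clear implicits.

(* [lorentz_cone R n] is the Lorentz cone of R^(n+1), so that [n : nat] ranges
   exactly over the Lorentz cones of the spaces R^m with m >= 1; the entry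
   [ord0] is the coordinate t. *)
Definition lorentz_cone (R : realType) (n : nat) : set 'rV[R]_n.+1 :=
  [set v : 'rV[R]_n.+1 |
    Num.sqrt (\sum_(i < n) v 0 (lift ord0 i) ^+ 2) <= v 0 ord0].
Arguments lorentz_cone : clear implicits.

Definition lorentzian {R : realType} {V : vectType R} (C : set V) : Prop :=
  exists (n : nat) (f : 'Hom('rV[R]_n.+1, V)),
    bijective f /\ f @` lorentz_cone R n = C.

Section Factorization.
Context {R : realType}.

Definition Pos {V1 V2 : vectType R} (C1 : set V1) (C2 : set V2) :
    set 'Hom(V1, V2) :=
  [set P | P @` C1 `<=` C2].

Definition convex_hull {E : lmodType R} (A : set E) : set E :=
  smallest (@convex_set R E) A.

Definition LorFact {V1 V2 : vectType R} (C1 : set V1) (C2 : set V2) :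
    set 'Hom(V1, V2) :=
  convex_hull [set P | exists (W : vectType R) (L : set W)
    (alpha : 'Hom(V1, W)) (beta : 'Hom(W, V2)),
    [/\ lorentzian L, Pos C1 L alpha, Pos L C2 beta
      & P = (beta \o alpha)%VF]].

Definition LFP {V1 V2 : vectType R} (C1 : set V1) (C2 : set V2) : Prop :=
  LorFact C1 C2 = Pos C1 C2.

End Factorization.

(* Main.v *)
(* A positive map from the square cone to C is a relation x1 + x3 = x2 + x4 in
   C, and it spans an extremal ray of Pos when the x_i lie on distinct extremal
   rays of C and span three dimensions. The factorization property then factors
   it through a single Lorentz cone, so in a three-dimensional section any four
   boundary points of C lie on a conic inscribed in C. An inscribed conic has at
   each of these points the same supporting line as C. Hence the conics through
   boundary points a, b and c belong to the pencil tangent to C at a and b, and c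
   determines a unique member of it: the whole boundary of the section lies on
   one conic.

   Fix an interior vector e and let p v be the least t with v + t e in C. The
   three-dimensional sections through e show that time v = (p(-v) - p v)/2 is
   linear and that width v = (p v + p(-v))/2 is the square root of a quadratic
   form on every plane. By the Jordan-von Neumann argument width is then a
   Euclidean seminorm with kernel R e, and C = {width <= time}. *)
Require Import Defs.
From HB Require Import structures.
From mathcomp Require Import all_boot all_order all_algebra.
From mathcomp Require Import all_classical reals topology normedtype convex.
From mathcomp Require Import ring lra.

Set Implicit Arguments.
Unset Strict Implicit.
Unset Printing Implicit Defensive.

Import Order.TTheory GRing.Theory Num.Theory.
Import numFieldNormedType.Exports.

Local Open Scope classical_set_scope.
Local Open Scope ring_scope.

(** * Sublinear functionals and the Hahn-Banach theorem in finite dimension *)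

Section Sublinear.
Context {R : realType} {V : vectType R}.
Implicit Types (p q f : V -> R) (u v a : V).

Definition sublinear p :=
  (forall t v, 0 <= t -> p (t *: v) = t * p v) /\
  (forall u v, p (u + v) <= p u + p v).

Lemma sublinear0 p : sublinear p -> p 0 = 0.
Proof. by move=> [pZ _]; rewrite -(scale0r 0) pZ// mul0r. Qed.

Lemma sublinear_subN p u : sublinear p -> 0 <= p u + p (- u).
Proof. by move=> sp; rewrite -(sublinear0 sp) -(subrr u); exact: sp.2. Qed.

(** The infimum of [p (v + t a) - t p a] over [t >= 0] is again sublinear and lies below [p];
    [v = - a], [t = 1] gives the last bound. As [q a + q (- a) >= 0], this makes [q] linear along
    [a] with [q a = p a]. *)
Lemma sublinear_linearize p a : sublinear p ->
  exists q, [/\ sublinear q, forall v, q v <= p v & q (- a) <= - p a].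
Proof.
move=> sp; have [pZ pD] := sp.
pose E v := [set p (v + t *: a) - t * p a | t in [set t : R | 0 <= t]].
have Elb v : lbound (E v) (- p (- v)).
  move=> _ [t /= t0 <-].
  have := pD (v + t *: a) (- v); rewrite addrAC subrr add0r pZ//; lra.
have E0 v : E v !=set0 by exists (p (v + 0 *: a) - 0 * p a); exists 0 => /=.
have Einf v t : 0 <= t -> inf (E v) <= p (v + t *: a) - t * p a.
  by move=> t0; apply: ge_inf; [exists (- p (- v)) | exists t].
pose q v := inf (E v).
have q0 : q 0 = 0.
  apply/eqP; rewrite eq_le; apply/andP; split.
    by have := Einf 0 0 (lexx _); rewrite scale0r addr0 mul0r subr0 sublinear0.
  apply: lb_le_inf => // x Ex.
  by have := Elb _ _ Ex; rewrite oppr0 sublinear0// oppr0.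
have qle t v : 0 < t -> q (t *: v) <= t * q v.
  move=> t0; rewrite mulrC -ler_pdivrMr//.
  apply: lb_le_inf => // _ [r /= r0 <-]; rewrite ler_pdivrMr//.
  apply: le_trans (Einf _ (t * r) _) _; first by rewrite mulr_ge0// ltW.
  by rewrite -scalerA -scalerDr (pZ _ _ (ltW t0)); lra.
exists q; split.
- split=> [t v|u v].
    rewrite le_eqVlt => /predU1P[<-|t0]; first by rewrite scale0r mul0r.
    apply/eqP; rewrite eq_le qle//=.
    have := qle t^-1 (t *: v); rewrite invr_gt0 => /(_ t0).
    rewrite scalerA mulVf ?gt_eqF// scale1r => H.
    by rewrite -ler_pdivlMl.
  rewrite -lerBlDr; apply: (lb_le_inf (E0 u)) => _ [t /= t0 <-].
  rewrite lerBlDr -lerBlDl; apply: (lb_le_inf (E0 v)) => _ [s /= s0 <-].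
  rewrite lerBlDl; apply: le_trans (Einf _ (t + s) _) _; first exact: addr_ge0.
  rewrite scalerDl addrACA mulrDl.
  by have := pD (u + t *: a) (v + s *: a); lra.
- by move=> v; have := Einf v 0 (lexx _); rewrite scale0r addr0 mul0r subr0.
- have := Einf (- a) 1 ler01; rewrite scale1r addNr sublinear0// mul1r.
  by rewrite sub0r.
Qed.

(** One direction is treated at a time. Later passes only decrease the functional, so the inequality
    gained along earlier directions persists; it expresses linearity along [v], the reverse
    inequality being automatic. *)
Lemma sublinear_linearize_seq p (s : seq V) : sublinear p ->
  exists q, [/\ sublinear q, forall v, q v <= p v
    & {in s, forall v, q v + q (- v) <= 0}].
Proof.
move=> sp; elim: s => [|a s [q [sq qp qs]]]; first by exists p; split.
have [q' [sq' q'q q'a]] := sublinear_linearize a sq.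
exists q'; split=> // [v|v]; first exact: le_trans (qp v).
rewrite inE => /predU1P[->|vs]; first by have := q'q a; lra.
by have := qs v vs; have := q'q v; have := q'q (- v); lra.
Qed.

(** Linearizing along [a] pins the value there; linearizing then along a basis makes the functional
    odd, hence linear. Finite dimension replaces Zorn's lemma. *)
Theorem hahn_banach_point p a : sublinear p ->
  exists f, [/\ scalar f, forall v, f v <= p v & f a = p a].
Proof.
move=> sp; have [q [sq qp qa]] := sublinear_linearize a sp.
have [f [sf fq fs]] := sublinear_linearize_seq (vbasis {:V}) sq.
have [fZ fD] := sf.
have fN v : f (- v) = - f v.
  suff : f v + f (- v) <= 0 by have := sublinear_subN v sf; lra.
  rewrite (coord_vbasis (memvf v)).
  elim/big_rec: _ => [|i u _ IH]; first by rewrite oppr0 sublinear0//; lra.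
  set w := _ *: _; suff wP : f w + f (- w) <= 0.
    by have := fD w u; have := fD (- w) (- u); rewrite -opprD; lra.
  have bi : f (vbasis {:V})`_i + f (- (vbasis {:V})`_i) <= 0.
    by apply: fs; rewrite mem_nth// size_tuple.
  rewrite /w; set c := coord _ _ _; case: (leP 0 c) => c0.
    by rewrite -scalerN !fZ// -mulrDr mulr_ge0_le0.
  have nc0 : 0 <= - c by rewrite oppr_ge0 ltW.
  by rewrite -[c]opprK scaleNr opprK addrC -scalerN !fZ// -mulrDr mulr_ge0_le0.
exists f; split => [c u v|v|]; last 2 first.
- exact: le_trans (qp v).
- have := fq (- a); have := fq a; have := qp a; rewrite fN; lra.
have fcu : f (c *: u) = c * f u.
  case: (leP 0 c) => c0; first exact: fZ.
  rewrite -[c]opprK scaleNr fN fZ ?oppr_ge0 ?(ltW c0)//; lra.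
have := fD (c *: u) v; have := fD (- (c *: u)) (- v).
by rewrite -opprD !fN -fcu; lra.
Qed.

End Sublinear.

(** * Elementary rules for linear forms *)

Section ScalarForms.
Context {R : realType} {V : vectType R} (f : V -> R).
Hypothesis fL : scalar f.

Lemma sformD u v : f (u + v) = f u + f v.
Proof. by have := fL 1 u v; rewrite scale1r mul1r. Qed.

Lemma sform0 : f 0 = 0.
Proof. by have := sformD 0 0; rewrite addr0; lra. Qed.

Lemma sformZ a u : f (a *: u) = a * f u.
Proof. by have := fL a u 0; rewrite addr0 sform0 addr0. Qed.

Lemma sformN u : f (- u) = - f u.
Proof. by rewrite -scaleN1r sformZ mulN1r. Qed.

End ScalarForms.

(** * Geometry of the Lorentz cone *)

Section Lorentz.
Context {R : realType} {n : nat}.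
Implicit Types u v w y : 'rV[R]_n.+1.

(** The Minkowski form, of signature [(1, n)], whose future cone is [lorentz_cone]. *)
Definition mink u v : R :=
  u 0 ord0 * v 0 ord0 - \sum_(i < n) u 0 (lift ord0 i) * v 0 (lift ord0 i).

Lemma minkC u v : mink u v = mink v u.
Proof.
by rewrite /mink mulrC; congr (_ - _); apply: eq_bigr => i _; rewrite mulrC.
Qed.

Lemma mink_scalar u : scalar (mink u).
Proof.
move=> a v w; rewrite /mink !mxE mulrDr mulrBr mulr_sumr.
rewrite addrACA -opprD mulrCA -big_split /=; congr (_ - _).
by apply: eq_bigr => i _; rewrite !mxE; ring.
Qed.

Lemma minkDr u v w : mink u (v + w) = mink u v + mink u w.
Proof. exact: (sformD (mink_scalar u)). Qed.

Lemma minkZr u a v : mink u (a *: v) = a * mink u v.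
Proof. exact: (sformZ (mink_scalar u)). Qed.

Lemma minkDl u v w : mink (v + w) u = mink v u + mink w u.
Proof. by rewrite !(minkC _ u) minkDr. Qed.

Lemma minkZl u a v : mink (a *: v) u = a * mink v u.
Proof. by rewrite !(minkC _ u) minkZr. Qed.

Lemma lorentz_coneP u :
  lorentz_cone R n u <-> 0 <= u 0 ord0 /\ 0 <= mink u u.
Proof.
have s0 : 0 <= \sum_(i < n) u 0 (lift ord0 i) ^+ 2.
  by apply: sumr_ge0 => i _; exact: sqr_ge0.
have mE : mink u u = u 0 ord0 ^+ 2 - \sum_(i < n) u 0 (lift ord0 i) ^+ 2.
  by rewrite /mink -expr2; congr (_ - _); apply: eq_bigr => i _; rewrite expr2.
rewrite mE subr_ge0 /lorentz_cone /=; split=> [h|[u0 h]].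
  have u0 : 0 <= u 0 ord0 := le_trans (sqrtr_ge0 _) h.
  by split => //; rewrite -(sqr_sqrtr s0) lerXn2r// nnegrE ?sqrtr_ge0.
by rewrite -(ger0_norm u0) -sqrtr_sqr ler_wsqrtr.
Qed.

Lemma lorentz_coneZ a u : 0 <= a -> lorentz_cone R n u ->
  lorentz_cone R n (a *: u).
Proof.
move=> a0 /lorentz_coneP[u0 uu]; apply/lorentz_coneP.
by rewrite mxE minkZl minkZr !mulr_ge0.
Qed.

Lemma lorentz_interior y u : lorentz_cone R n y -> 0 < mink y y ->
  exists2 e, 0 < e & lorentz_cone R n (y - e *: u).
Proof.
move=> /lorentz_coneP[y0 _] yy.
have {}y0 : 0 < y 0 ord0.
  rewrite lt_neqAle y0 andbT eq_sym; apply: contraTneq yy => y00.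
  rewrite -leNgt /mink y00 mul0r sub0r oppr_le0.
  by apply: sumr_ge0 => i _; rewrite -expr2 sqr_ge0.
(* [K] dominates the perturbations of both inequalities defining the cone and [m] bounds the room
   left in them, so [e = m / K] is small enough. Since [e <= 1], the quadratic term is controlled by
   a linear one. *)
pose K := 1 + `|u 0 ord0| + 2 * `|mink y u| + `|mink u u|.
have K1 : 1 <= K.
  have := normr_ge0 (u 0 ord0); have := normr_ge0 (mink y u).
  by have := normr_ge0 (mink u u); rewrite /K; lra.
have K0 : 0 < K by lra.
pose m := Num.min 1 (Num.min (y 0 ord0) (mink y y)).
have m0 : 0 < m by rewrite !lt_min ltr01 y0 yy.
have m1 : m <= 1 by rewrite ge_min lexx.
have my : m <= y 0 ord0 by rewrite !ge_min lexx !orbT.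
have mq : m <= mink y y by rewrite !ge_min lexx !orbT.
exists (m / K); first exact: divr_gt0.
set e := m / K; have eK : e * K = m by rewrite /e divfK// gt_eqF.
have e0 : 0 < e by exact: divr_gt0.
have e1 : e <= 1 by rewrite ler_pdivrMr// mul1r; lra.
move: (ler_norm (u 0 ord0)) (ler_norm (mink y u)) (ler_norm (- mink u u)).
rewrite normrN => h1 h2 h3.
have := normr_ge0 (u 0 ord0); have := normr_ge0 (mink y u).
have := normr_ge0 (mink u u); move=> n3 n2 n1.
apply/lorentz_coneP; split.
  by rewrite !mxE subr_ge0; apply: le_trans my; rewrite -eK ler_pM2l// /K; lra.
rewrite -scaleNr minkDl !minkDr !minkZl !minkZr (minkC u y).
have h2' : e * (2 * mink y u) <= e * (2 * `|mink y u|).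
  by rewrite ler_pM2l//; lra.
have h3' : e * (e * - mink u u) <= e * `|mink u u|.
  rewrite ler_pM2l//; apply: (@le_trans _ _ (e * `|mink u u|)).
    by rewrite ler_pM2l.
  by rewrite -[leRHS]mul1r ler_wpM2r.
have n1' := mulr_ge0 (ltW e0) n1.
by rewrite /K in eK; nra.
Qed.

(** Equality case of the reversed Cauchy-Schwarz inequality: the combination [z] of [w] and [y] with
    zero time coordinate has [mink z z >= 0], so its spatial part vanishes too. *)
Lemma null_orthogonal w y : lorentz_cone R n w -> lorentz_cone R n y ->
  y != 0 -> mink y y = 0 -> mink w y = 0 -> exists l, w = l *: y.
Proof.
move=> /lorentz_coneP[w0 ww] /lorentz_coneP[y0 _] yn0 yy wy.
have {}y0 : 0 < y 0 ord0.
  rewrite lt_neqAle y0 andbT eq_sym; apply: contraNneq yn0 => y00.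
  apply/eqP/rowP => j; rewrite mxE; case: (unliftP ord0 j) => [i ->|->//].
  apply/eqP; rewrite -sqrf_eq0.
  have /eqP := yy; rewrite /mink y00 mul0r sub0r oppr_eq0 psumr_eq0.
    by move/allP => /(_ i); rewrite mem_index_enum expr2 => /(_ isT).
  by move=> k _; rewrite -expr2 sqr_ge0.
exists (w 0 ord0 / y 0 ord0).
pose z := y 0 ord0 *: w - w 0 ord0 *: y.
have zz : 0 <= mink z z.
  rewrite /z -scaleNr minkDl !minkDr !minkZl !minkZr (minkC y w) wy yy.
  by rewrite !mulr0 !addr0 mulr_ge0// ?mulr_ge0 // ltW.
have z0 : z 0 ord0 = 0 by rewrite !mxE; ring.
have {zz} zE i : z 0 (lift ord0 i) = 0.
  apply/eqP; rewrite -sqrf_eq0 expr2 eq_le -!expr2 sqr_ge0 andbT.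
  move: zz; rewrite /mink z0 mul0r sub0r oppr_ge0; apply: le_trans.
  rewrite (bigD1 i)//= expr2 lerDl; apply: sumr_ge0 => k _.
  by rewrite -expr2 sqr_ge0.
have : z = 0.
  apply/rowP => j; rewrite [RHS]mxE; case: (unliftP ord0 j) => [i ->|->//].
  exact: zE.
move/subr0_eq => h; rewrite mulrC -scalerA -h scalerA mulVf ?scale1r//.
by rewrite gt_eqF.
Qed.

Lemma mink_riesz (f : 'rV[R]_n.+1 -> R) : scalar f ->
  exists w, forall u, f u = mink w u.
Proof.
move=> fL; exists (\row_j ((if j == ord0 then 1 else -1) * f (delta_mx 0 j))).
move=> u; rewrite [in LHS](row_sum_delta u).
rewrite (big_morph f (sformD fL) (sform0 fL)) big_ord_recl /mink !mxE.
rewrite -sumrN eqxx (sformZ fL); congr (_ + _); first by rewrite mul1r mulrC.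
apply: eq_bigr => i _; rewrite !mxE (sformZ fL) /=; ring.
Qed.

(** The test vector has the spatial part of [w] and the least admissible time coordinate; when that
    spatial part is zero, the unit time vector serves. *)
Lemma lorentz_self_dual w :
  (forall u, lorentz_cone R n u -> 0 <= mink w u) -> lorentz_cone R n w.
Proof.
move=> h; rewrite /lorentz_cone /=.
set s := \sum_(i < n) _; have s0 : 0 <= s.
  by apply: sumr_ge0 => i _; exact: sqr_ge0.
have [->|sn0] := eqVneq s 0.
  rewrite sqrtr0; have := h (delta_mx 0 ord0).
  rewrite /mink !mxE /= mulr1 big1 ?subr0.
    apply; rewrite /lorentz_cone /= big1; first by rewrite sqrtr0 !mxE ler01.
    by move=> i _; rewrite !mxE expr0n.
  by move=> i _; rewrite !mxE mulr0.
have rs : 0 < Num.sqrt s by rewrite sqrtr_gt0 lt_neqAle eq_sym sn0.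
pose u : 'rV[R]_n.+1 := \row_j if j == ord0 then Num.sqrt s else w 0 j.
have u0 : u 0 ord0 = Num.sqrt s by rewrite mxE.
have ui i : u 0 (lift ord0 i) = w 0 (lift ord0 i) by rewrite mxE.
have := h u; rewrite /mink u0 /lorentz_cone /= u0.
under eq_bigr do rewrite ui.
under [in X in _ - X]eq_bigr do rewrite ui -expr2.
rewrite -/s => /(_ (lexx _)).
by rewrite subr_ge0 -{1}(sqr_sqrtr s0) expr2 ler_pM2r.
Qed.

(** The Lorentz cone is smooth along its null rays: by self-duality the functional is represented by
    a vector of the cone orthogonal to [y], hence by a multiple of [y]. *)
Lemma lorentz_support (f : 'rV[R]_n.+1 -> R) y : scalar f ->
  (forall u, lorentz_cone R n u -> 0 <= f u) ->
  lorentz_cone R n y -> y != 0 -> mink y y = 0 -> f y = 0 ->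
  exists l, forall u, f u = l * mink y u.
Proof.
move=> fL f0 Ly yn0 yy fy; have [w fE] := mink_riesz fL.
have Lw : lorentz_cone R n w.
  by apply: lorentz_self_dual => u Lu; rewrite -fE f0.
have [|l wE] := null_orthogonal Lw Ly yn0 yy; first by rewrite -fE.
by exists l => u; rewrite fE wE minkZl.
Qed.

(** The equation of a conic in the pencil tangent to two lines at [y1] and [y2]: [mink y1] and
    [mink y2] are the tangents, and [r] is the coordinate vanishing on the chord. *)
Lemma mink_four_null y1 y2 y3 p q r : let y4 := p *: y1 + q *: y2 + r *: y3 in
  mink y1 y1 = 0 -> mink y2 y2 = 0 -> mink y3 y3 = 0 -> mink y4 y4 = 0 ->
  mink y1 y4 * mink y2 y4 = r ^+ 2 * (mink y1 y3 * mink y2 y3).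
Proof.
rewrite /= !minkDl !minkDr !minkZl !minkZr => h1 h2 h3.
rewrite (minkC y2 y1) (minkC y3 y1) (minkC y3 y2) h1 h2 h3 => h4.
(* The two sides differ by [mink y1 y2 * mink y4 y4 / 2]. *)
by have := congr1 ( *%R (mink y1 y2)) h4; lra.
Qed.

End Lorentz.

Lemma eq_scalar {R : realType} {V : vectType R} (u v : V) :
  (forall f : V -> R, scalar f -> f u = f v) -> u = v.
Proof.
move=> h; rewrite (coord_vbasis (memvf u)) (coord_vbasis (memvf v)).
apply: eq_bigr => i _; congr (_ *: _); apply: (h (coord (vbasis {:V}) i)).
by move=> a x y; rewrite linearP.
Qed.

(* Linear identities between vectors become ring identities of scalars. *)
Ltac vfield :=
  apply: eq_scalar; let f := fresh "f" in let fL := fresh "fL" in intros f fL;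
  rewrite ?(sformD fL, sformN fL, sformZ fL, sform0 fL); field.

(** * Order units, gauges and boundary points of proper cones *)

Section ProperCones.
Context {R : realType} {V : vectType R}.
Implicit Types (C : set V) (e v x y z : V).

Lemma convex_cone_sum C (I : Type) (r : seq I) (P : pred I) (F : I -> V) :
  convex_cone C -> (forall i, P i -> C (F i)) -> C (\sum_(i <- r | P i) F i).
Proof. by case=> C0 CD _ CF; elim/big_ind: _ => //; exact: CD. Qed.

(** Each basis vector needs only finitely many elements of [C]; concatenating these sequences gives
    one that works for all vectors. *)
Lemma generating_seq C : linear_span C = [set: V] ->
  exists s : seq V, {in s, forall x, C x} /\ forall v, v \in <<s>>%VS.
Proof.
move=> span.
suff [s [sC bs]] : exists s : seq V, {in s, forall x, C x} /\
    {subset (vbasis {:V} : seq V) <= <<s>>%VS}.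
  exists s; split => // v; have := memvf v.
  by rewrite -(span_basis (vbasisP {:V})); apply/subvP/span_subvP.
elim: (vbasis {:V} : seq V) => [|b r [s [sC rs]]]; first by exists [::].
have : linear_span C b by rewrite span.
move=> [s' s'C bs']; exists (s' ++ s); split.
  by move=> x; rewrite mem_cat => /orP[/s'C|/sC].
move=> x; rewrite span_cat inE => /predU1P[->|/rs xs].
  exact: (subvP (addvSl _ _)).
exact: (subvP (addvSr _ _)).
Qed.

(** Take for [e] the sum of a finite generating family: adding to [v] the multiple of [e] by the sum
    of the absolute values of its coordinates makes every coefficient nonnegative. *)
Lemma proper_cone_order_unit C : (0 < \dim {:V})%N -> proper_cone C ->
  exists e, [/\ C e, ~ C (- e) & forall v, exists t, C (v + t *: e)].
Proof.
move=> dimV [cC _ pointed span]; have [C0 CD CZ] := cC.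
have [s [sC sV]] := generating_seq span.
pose e := \sum_(i < size s) s`_i.
have Cs i : C s`_(i : 'I_(size s)) by apply: sC; rewrite mem_nth.
have unit v : exists t, C (v + t *: e).
  have vE := coord_span (sV v : v \in <<in_tuple s>>%VS).
  exists (\sum_(i < size s) `|coord (in_tuple s) i v|).
  rewrite {1}vE /e scaler_sumr -big_split /=.
  apply: convex_cone_sum => // i _; rewrite -scalerDl; apply: CZ => //.
  rewrite (bigD1 i)//= addrA addr_ge0//.
    by rewrite -lerBlDl sub0r -normrN ler_norm.
  exact: sumr_ge0.
have Ce : C e by apply: convex_cone_sum => // i _; exact: Cs.
exists e; split => // CNe.
have CNC x : C x -> C (- x) -> x = 0.
  move=> Cx CNx; have : (C `&` [set - x | x in C]) x.
    by split => //; exists (- x) => //; rewrite opprK.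
  by rewrite pointed.
(* If [- e] were in [C], pointedness would give [e = 0]; then [C] would be the whole space, which
   pointedness reduces to zero. *)
have e0 : e = 0.
  exact: CNC.
have CV v : C v by have [t] := unit v; rewrite e0 scaler0 addr0.
have V0 v : v = 0 by exact: CNC.
move: dimV; rewrite lt0n dimv_eq0; case/negP; apply/eqP/vspaceP => v.
by rewrite (V0 v) !mem0v.
Qed.

Lemma line_continuous (n : nat) (a b : 'rV[R]_n) :
  continuous (fun r : R => a - r *: b).
Proof.
move=> r; apply: cvgB; first exact: cvg_cst.
by apply: cvgZr_tmp; exact: cvg_id.
Qed.

Let bas := vbasis {:V}.

Let coords_line C v e r :
  coords C (passmx.rVof bas v - r *: passmx.rVof bas e) = C (v - r *: e).
Proof.
rewrite /coords /= -/bas -scaleNr addrC -(passmx.rVof_linear bas).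
by rewrite passmx.rVofK ?vbasisP// scaleNr addrC.
Qed.

(** [- p v] is the largest [r] with [v - r e] in [C]. The supremum is attained because [C] is
    closed, and finite because [- e] is not in [C]. *)
Lemma proper_cone_gauge C e : proper_cone C -> C e -> ~ C (- e) ->
  (forall v, exists t, C (v + t *: e)) ->
  exists p : V -> R, forall v t, C (v + t *: e) <-> p v <= t.
Proof.
move=> [[C0 CD CZ] Ccl _ _] Ce Ne unit.
pose B v := [set r : R | C (v - r *: e)].
have Bcl v : closed (B v).
  have -> : B v = (fun r : R => passmx.rVof bas v - r *: passmx.rVof bas e)
                  @^-1` coords C.
    by apply/funext => r; rewrite /B /preimage /= coords_line.
  by apply: (continuous_closedP _).1 => //; exact: line_continuous.
have B0 v : B v !=set0.
  by have [t] := unit v; exists (- t); rewrite /B /= scaleNr opprK.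
have Bub v : has_ubound (B v).
  have [u Cu] := unit (- v); exists u => r Br; rewrite leNgt; apply/negP => ur.
  apply: Ne; have := CZ (r - u)^-1 _ _ (CD _ _ Br Cu).
  have -> : v - r *: e + (- v + u *: e) = (r - u) *: (- e).
    by rewrite scalerN -scaleNr opprB scalerBl addrACA subrr add0r addrC.
  rewrite scalerA mulVf ?subr_eq0 ?gt_eqF// scale1r; apply.
  by rewrite invr_ge0 subr_ge0 ltW.
have Bsup v : B v (sup (B v)).
  by have := closure_sup (B0 v) (Bub v); rewrite -((closure_id _).1 (Bcl v)).
exists (fun v => - sup (B v)) => v t; split=> [Ct|].
  by rewrite lerNl; apply: ub_le_sup => //; rewrite /B /= scaleNr opprK.
rewrite -subr_ge0 => /CZ/(_ Ce)/(CD _ _ (Bsup v)).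
by rewrite opprK scalerDl addrA addrAC addrNK.
Qed.

(** An interior point could be moved a little along [- e] inside [C], against [p v = 0]. *)
Lemma gauge0_boundary C e p : C e -> convex_cone C ->
  (forall v t, C (v + t *: e) <-> p v <= t) ->
  forall v, p v = 0 -> vboundary C v.
Proof.
move=> Ce [C0 CD CZ] pP v pv; split.
  apply: subset_closure; have := coords_line C v e 0; rewrite !scale0r !subr0.
  by move=> ->; have := (pP v 0).2; rewrite pv scale0r addr0 => /(_ (lexx _)).
rewrite /interior /= => nb.
have : nbhs (0 : R) [set r | C (v - r *: e)].
  have := @line_continuous _ (passmx.rVof bas v) (passmx.rVof bas e) 0.
  rewrite /continuous_at scale0r subr0 => /(_ _ nb).
  rewrite /fmap /= => nb'; suff <- : (fun r : R => passmx.rVof bas v -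
      r *: passmx.rVof bas e) @^-1` coords C = [set r | C (v - r *: e)] by [].
  by apply/funext => r; rewrite /preimage /= coords_line.
move=> /nbhs_ballP[d /= d0 dC].
have : C (v - (d / 2) *: e).
  have /= := dC (d / 2); apply; rewrite /ball /= sub0r normrN ger0_norm; lra.
by rewrite -scaleNr => /pP; rewrite pv; lra.
Qed.

End ProperCones.

(** * Extremal elements of a cone *)

Section Extreme.
Context {R : realType} {V : vectType R}.
Implicit Types (C : set V) (u v x y z : V).

(** The face condition on the ray of [x], stated on elements. It admits [x = 0], so that it can hold
    at every zero of the gauge. *)
Definition extreme C x := C x /\
  forall y z, C y -> C z -> x = y + z -> exists2 t, 0 <= t & y = t *: x.

Definition indep3 x y z := forall r s t : R,
  r *: x + s *: y + t *: z = 0 -> [/\ r = 0, s = 0 & t = 0].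

Lemma extremeZ C a x : convex_cone C -> 0 < a -> extreme C x ->
  extreme C (a *: x).
Proof.
move=> [_ _ CZ] a0 [Cx ex]; split; first by apply: CZ => //; exact: ltW.
have ai0 : 0 <= a^-1 by rewrite invr_ge0 ltW.
have an0 : a != 0 by rewrite gt_eqF.
move=> y z Cy Cz axE.
have [|t t0 yE] := ex _ _ (CZ _ _ ai0 Cy) (CZ _ _ ai0 Cz).
  by rewrite -scalerDr -axE scalerA mulVf// scale1r.
exists t => //; rewrite scalerA mulrC -scalerA -yE scalerA divff//.
by rewrite scale1r.
Qed.

End Extreme.

(** * Maps from the square cone as relations between four vectors *)

Section SquareMap.
Context {R : realType} {V : vectType R}.

Definition row3 (a b c : R) : 'rV[R]_3 := \row_(j < 3) [:: a; b; c]`_j.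

Lemma row3E a b c :
  (row3 a b c 0 0 = a) * (row3 a b c 0 1 = b) * (row3 a b c 0 2%:R = c).
Proof. by rewrite !mxE. Qed.

Lemma eq_row3 (u v : 'rV[R]_3) :
  u 0 0 = v 0 0 -> u 0 1 = v 0 1 -> u 0 2%:R = v 0 2%:R -> u = v.
Proof.
move=> h0 h1 h2; apply/rowP => -[[|[|[|//]]] i].
- by have -> : Ordinal i = 0 by apply/val_inj.
- by have -> : Ordinal i = 1 by apply/val_inj.
- by have -> : Ordinal i = 2%:R by apply/val_inj.
Qed.

(** Generators of the four extremal rays of the square cone, in cyclic order: opposite ones have the
    same sum. *)
Definition vx1 := row3 1 1 0.
Definition vx2 := row3 1 0 1.
Definition vx3 := row3 1 (-1) 0.
Definition vx4 := row3 1 0 (-1).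

Lemma vx_square_cone :
  [/\ square_cone R vx1, square_cone R vx2, square_cone R vx3 &
      square_cone R vx4].
Proof.
by split; rewrite /square_cone /= !row3E ?normrN ?normr0 ?normr1 ?addr0 ?add0r.
Qed.

Lemma vx_relation : vx1 + vx3 = vx2 + vx4.
Proof. by apply: eq_row3; rewrite !mxE /=; ring. Qed.

Lemma vx_decomp (v : 'rV[R]_3) :
  v = ((v 0 0 - v 0 2%:R + v 0 1) / 2) *: vx1 + v 0 2%:R *: vx2
    + ((v 0 0 - v 0 2%:R - v 0 1) / 2) *: vx3.
Proof. by apply: eq_row3; rewrite !mxE /=; field. Qed.

(** The linear map sending the basis [vx1], [vx2], [vx3] to [X1], [X2], [X3]. *)
Definition square_map (X1 X2 X3 : V) (v : 'rV[R]_3) : V :=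
  ((v 0 0 - v 0 2%:R + v 0 1) / 2) *: X1 + v 0 2%:R *: X2
  + ((v 0 0 - v 0 2%:R - v 0 1) / 2) *: X3.

Lemma square_map_linear X1 X2 X3 : linear (square_map X1 X2 X3).
Proof.
by move=> a u v; rewrite /square_map !mxE; vfield.
Qed.

HB.instance Definition _ X1 X2 X3 :=
  GRing.isLinear.Build R 'rV[R]_3 V _ (square_map X1 X2 X3)
    (square_map_linear X1 X2 X3).

Lemma square_map_vx X1 X2 X3 X4 (P := linfun (square_map X1 X2 X3)) :
  X1 + X3 = X2 + X4 -> [/\ P vx1 = X1, P vx2 = X2, P vx3 = X3 & P vx4 = X4].
Proof.
move=> rel; have P1 : P vx1 = X1.
  by rewrite lfunE /= /square_map !row3E; vfield.
have P2 : P vx2 = X2 by rewrite lfunE /= /square_map !row3E; vfield.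
have P3 : P vx3 = X3 by rewrite lfunE /= /square_map !row3E; vfield.
clearbody P; split => //; apply: (@addrI _ X2); rewrite -rel.
by have := congr1 P vx_relation; rewrite !linearD /= P1 P2 P3 => <-.
Qed.

Lemma square_map_Pos C X1 X2 X3 X4 : convex_cone C -> X1 + X3 = X2 + X4 ->
  C X1 -> C X2 -> C X3 -> C X4 ->
  Pos (square_cone R) C (linfun (square_map X1 X2 X3)).
Proof.
move=> [C0 CD CZ] rel C1 C2 C3 C4 _ [v /= sv <-].
rewrite lfunE /= /square_map; rewrite /square_cone /= in sv.
set a := v 0 0 in sv *; set b := v 0 1 in sv *; set c := v 0 2%:R in sv *.
(* Positive and negative parts of [b] go to [X1] and [X3], those of [c] to [X2] and [X4], and the
   slack in the cone inequality to the common sum. *)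
have -> : ((a - c + b) / 2) *: X1 + c *: X2 + ((a - c - b) / 2) *: X3 =
   ((a - `|b| - `|c|) / 2) *: (X1 + X3) + ((`|b| + b) / 2) *: X1
   + ((`|b| - b) / 2) *: X3 + ((`|c| + c) / 2) *: X2 + ((`|c| - c) / 2) *: X4.
  have -> : X4 = X1 + X3 - X2 by rewrite rel addrAC subrr add0r.
  by vfield.
have := ler_norm b; have := ler_norm (- b); rewrite normrN => b1 b2.
have := ler_norm c; have := ler_norm (- c); rewrite normrN => c1 c2.
by do 4 (apply: (CD); last by apply: CZ => //; lra);
  apply: CZ; [lra | exact: CD].
Qed.

End SquareMap.

(** * Lifting four extremal vectors to null vectors of one Lorentz cone *)

Section NullLift.
Context {R : realType} {V : vectType R}.
Implicit Types (C : set V) (x X : V).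

Definition null_lift n (b : 'Hom('rV[R]_n.+1, V)) y x :=
  [/\ lorentz_cone R n y, mink y y = 0 & b y = x].

Lemma null_liftZ n (b : 'Hom('rV[R]_n.+1, V)) y x a : 0 <= a ->
  null_lift b y x -> null_lift b (a *: y) (a *: x).
Proof.
move=> a0 [Ly yy <-]; split; first exact: lorentz_coneZ.
  by rewrite minkZl minkZr yy !mulr0.
by rewrite linearZ.
Qed.

(** If [y] were interior, subtracting a small multiple of [u] would exhibit a multiple of [b u] as a
    summand of [x], and extremality would make [b u] proportional to [x]. *)
Lemma extreme_null_lift C n (b : 'Hom('rV[R]_n.+1, V)) y u x :
  (forall w, lorentz_cone R n w -> C (b w)) -> convex_cone C ->
  extreme C x -> lorentz_cone R n y -> b y = x -> lorentz_cone R n u ->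
  (forall t, b u <> t *: x) -> null_lift b y x.
Proof.
move=> bC [_ _ CZ] [_ ex] Ly by_x Lu bu; split=> //.
apply/eqP; rewrite eq_le ((lorentz_coneP y).1 Ly).2 andbT leNgt.
apply/negP => yy.
have [e e0 Lyu] := lorentz_interior u Ly yy.
have [||t _ euE] := ex (e *: b u) (b (y - e *: u)) _ (bC _ Lyu).
- by apply: CZ; [exact: ltW | exact: bC].
- by rewrite linearB linearZ /= addrC subrK.
apply: (bu (e^-1 * t)).
by rewrite -scalerA -euE scalerA mulVf ?scale1r// gt_eqF.
Qed.

Section Relation.
Variables (C : set V) (X1 X2 X3 X4 : V).
Hypotheses (cC : convex_cone C) (rel : X1 + X3 = X2 + X4)
  (ind : indep3 X1 X2 X3)
  (eX1 : extreme C X1) (eX2 : extreme C X2)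
  (eX3 : extreme C X3) (eX4 : extreme C X4).

Let P := linfun (square_map X1 X2 X3).

(** [P] spans an extremal ray of [Pos]: extremality of each [Xi] makes [M1] a multiple of [P] at
    each vertex, and the relation between the vertices equates the four factors. *)
Lemma square_map_extreme M1 M2 (k l r : R) : 0 < k -> 0 <= l -> 0 < r ->
  Pos (square_cone R) C M1 -> Pos (square_cone R) C M2 ->
  k *: M1 + l *: M2 = r *: P -> exists2 m, 0 <= m & M1 = m *: P.
Proof.
move=> k0 l0 r0 M1C M2C ME; have [_ _ CZ] := cC.
have [Pv1 Pv2 Pv3 Pv4] := square_map_vx rel.
have [S1 S2 S3 S4] := @vx_square_cone R.
have kr0 : 0 <= k / r by rewrite divr_ge0// ltW.
have lr0 : 0 <= l / r by rewrite divr_ge0// ltW.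
have scaled w X : square_cone R w -> P w = X -> extreme C X ->
    exists2 m, 0 <= m & M1 w = m *: X.
  move=> Sw Pw [_ ex].
  have [|||t t0 tE] := ex ((k / r) *: M1 w) ((l / r) *: M2 w).
  - by apply: CZ; [exact: kr0 | apply: M1C; exists w].
  - by apply: CZ; [exact: lr0 | apply: M2C; exists w].
  - have := congr1 (fun f : 'Hom(_, _) => r^-1 *: f w) ME.
    rewrite add_lfunE !scale_lfunE Pw scalerDr !scalerA mulVf ?gt_eqF//.
    by rewrite scale1r ![r^-1 * _]mulrC.
  exists (t * (r / k)); first by rewrite mulr_ge0// divr_ge0// ltW.
  rewrite mulrC -scalerA -tE scalerA; set c := _ * _.
  have -> : c = 1 by rewrite /c; field; rewrite !gt_eqF.
  by rewrite scale1r.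
have [m1 m10 E1] := scaled _ _ S1 Pv1 eX1.
have [m2 _ E2] := scaled _ _ S2 Pv2 eX2.
have [m3 _ E3] := scaled _ _ S3 Pv3 eX3.
have [m4 _ E4] := scaled _ _ S4 Pv4 eX4.
(* Apply [M1] to the vertex relation and eliminate [X4]. *)
have [|h1 h2 h3] := ind (r := m1 - m4) (s := m4 - m2) (t := m3 - m4).
  have := congr1 M1 (@vx_relation R); rewrite !linearD /= E1 E2 E3 E4.
  have -> : X4 = X1 + X3 - X2 by rewrite rel addrAC subrr add0r.
  move=> /eqP; rewrite -subr_eq0 => /eqP h; by rewrite -[RHS]h; vfield.
exists m1 => //; apply/lfunP => v; rewrite scale_lfunE (vx_decomp v).
rewrite !linearD !linearZ /= E1 E2 E3 Pv1 Pv2 Pv3.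
have -> : m2 = m1 by lra.
have -> : m3 = m1 by lra.
by vfield.
Qed.

(** Extremality of [P] reduces a convex combination of factorizations to a single one. The vertices
    then have images in one Lorentz cone, null because the [Xi] are extremal and pairwise not
    proportional. *)
Lemma LFP_null_lift : LFP (square_cone R) C ->
  exists n (b : 'Hom('rV[R]_n.+1, V)), exists y1 y2 y3 y4,
  [/\ [/\ null_lift b y1 X1, null_lift b y2 X2, null_lift b y3 X3
        & null_lift b y4 X4],
      y1 + y3 = y2 + y4 & forall w, lorentz_cone R n w -> C (b w)].
Proof.
move=> lfp; set Goal := ex _.
have [Pv1 Pv2 Pv3 Pv4] := square_map_vx rel.
have [S1 S2 S3 S4] := @vx_square_cone R.
(* As [P] spans an extremal ray of [Pos], [T] is convex; it contains every
   map that factors through a Lorentz cone. *)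
pose T := [set M : 'Hom('rV[R]_3, V) | Pos (square_cone R) C M /\
  forall r, 0 < r -> M = r *: P -> Goal].
have PosP : Pos (square_cone R) C P.
  by apply: square_map_Pos rel _ _ _ _ => //;
    [case: eX1 | case: eX2 | case: eX3 | case: eX4].
suff : T P by case=> _ /(_ 1 ltr01); rewrite scale1r; apply.
have : LorFact (square_cone R) C P by rewrite lfp.
apply: smallest_sub => {PosP}.
- apply/convex_setW => M1 M2; rewrite !inE => -[pM1 tM1] [pM2 tM2] k k0 k1.
  set kr := interval_inference.Itv.r k in k0 k1.
  have -> : conv k M1 M2 = kr *: M1 + (1 - kr) *: M2 by [].
  have l0 : 0 < 1 - kr by rewrite subr_gt0.
  apply: mem_set; split.
    have [_ CD CZ] := cC; move=> _ [v Sv <-]; rewrite add_lfunE !scale_lfunE.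
    by apply: CD; apply: CZ; rewrite ?ltW//; [apply: pM1|apply: pM2]; exists v.
  move=> r r0 ME.
  have [m m0 M1E] := square_map_extreme k0 (ltW l0) r0 pM1 pM2 ME.
  (* When [m = 0] the first map vanishes, and the second is a positive multiple of [P]. *)
  move: m0; rewrite le_eqVlt => /predU1P[m0|m0]; last exact: tM1 M1E.
  apply: (tM2 (r / (1 - kr))); first exact: divr_gt0.
  move: ME; rewrite M1E -m0 scale0r scaler0 add0r mulrC -scalerA => <-.
  by rewrite scalerA mulVf ?scale1r// gt_eqF.
- move=> _ [W [L [al [be [[n [f [fbij fL]]] alP beP ->]]]]]; split.
    move=> _ [v Sv <-]; rewrite comp_lfunE; apply: beP; exists (al v) => //.
    by apply: alP; exists v.
  move=> r r0 ME; pose b := r^-1 *: (be \o f)%VF.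
  have bC w : lorentz_cone R n w -> C (b w).
    have [_ _ CZ] := cC; move=> Lw; rewrite scale_lfunE comp_lfunE.
    apply: CZ; first by rewrite invr_ge0 ltW.
    by apply: beP; exists (f w) => //; rewrite -fL; exists w.
  have lift w X : square_cone R w -> P w = X ->
      exists y, [/\ lorentz_cone R n y, b y = X & f y = al w].
    move=> Sw Pw; have : L (al w) by apply: alP; exists w.
    rewrite -fL => -[y Ly fy]; exists y; split => //.
    have := congr1 (fun g : 'Hom(_, _) => r^-1 *: g w) ME.
    rewrite /b !scale_lfunE !comp_lfunE fy => ->.
    by rewrite Pw scalerA mulVf ?scale1r// gt_eqF.
  have [y1 [L1 B1 f1]] := lift _ _ S1 Pv1.
  have [y2 [L2 B2 f2]] := lift _ _ S2 Pv2.
  have [y3 [L3 B3 f3]] := lift _ _ S3 Pv3.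
  have [y4 [L4 B4 f4]] := lift _ _ S4 Pv4.
  exists n, b, y1, y2, y3, y4; split => //; last first.
    (* The relation already holds between the images of the vertices in [W]; the isomorphism [f]
       carries it back. *)
    apply: (bij_inj fbij); rewrite !linearD /= f1 f2 f3 f4 -!linearD /=.
    by rewrite vx_relation.
  split.
  - apply: (extreme_null_lift bC cC eX1 L1 B1 L2) => t; rewrite B2 => h.
    have [|] := ind (r := t) (s := -1) (t := 0); last lra.
    by rewrite h; vfield.
  - apply: (extreme_null_lift bC cC eX2 L2 B2 L1) => t; rewrite B1 => h.
    have [|] := ind (r := 1) (s := - t) (t := 0); last lra.
    by rewrite h; vfield.
  - apply: (extreme_null_lift bC cC eX3 L3 B3 L1) => t; rewrite B1 => h.
    have [|] := ind (r := 1) (s := 0) (t := - t); last lra.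
    by rewrite h; vfield.
  - apply: (extreme_null_lift bC cC eX4 L4 B4 L1) => t; rewrite B1.
    have -> : X4 = X1 + X3 - X2 by rewrite rel addrAC subrr add0r.
    move=> h; have [|] := ind (r := t - 1) (s := - t) (t := t); last lra.
    by rewrite -[RHS](subrr X1) {2}h; vfield.
Qed.

End Relation.

End NullLift.

(** * The gauge of the cone along an interior direction *)

Section Gauge.
Context {R : realType} {V : vectType R} {C : set V} {e : V} {p : V -> R}.
Hypotheses (cC : convex_cone C)
  (pointed : forall x, C x -> C (- x) -> x = 0)
  (CNe : ~ C (- e))
  (pP : forall v t, C (v + t *: e) <-> p v <= t)
  (ext : forall v, p v = 0 -> extreme C v).
Implicit Types (a b c d u v x y z : V).

Lemma gaugeP v : C v <-> p v <= 0.
Proof. by rewrite -pP scale0r addr0. Qed.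

Lemma gauge_mem v : C (v + p v *: e).
Proof. exact/pP. Qed.

Lemma gauge_shift v t : p (v + t *: e) = p v - t.
Proof.
apply/eqP; rewrite eq_le; apply/andP; split.
  apply/pP; have -> : v + t *: e + (p v - t) *: e = v + p v *: e by vfield.
  exact: gauge_mem.
rewrite lerBlDr; apply/pP; set q := p _.
have -> : v + (q + t) *: e = v + t *: e + q *: e by vfield.
exact: gauge_mem.
Qed.

Lemma gauge_boundary v : p (v + p v *: e) = 0.
Proof. by rewrite gauge_shift subrr. Qed.

Lemma gauge0 : p 0 = 0.
Proof.
have [C0 _ CZ] := cC; apply/eqP; rewrite eq_le; apply/andP; split.
  by apply/gaugeP.
rewrite leNgt; apply/negP => p0; apply: CNe.
have := CZ (- p 0)^-1 _ _ (gauge_mem 0); rewrite add0r invr_ge0 oppr_ge0 ltW//.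
move=> /(_ isT); rewrite scalerA invrN mulNr mulVf ?scaleN1r//.
by rewrite lt_eqF.
Qed.

Lemma gauge_sublinear : sublinear p.
Proof.
have [C0 CD CZ] := cC.
have pZ t v : 0 < t -> p (t *: v) <= t * p v.
  move=> t0; apply/pP; rewrite -scalerA -scalerDr.
  by apply: CZ; [exact: ltW | exact: gauge_mem].
split=> [t v|u v].
  rewrite le_eqVlt => /predU1P[<-|t0]; first by rewrite scale0r mul0r gauge0.
  apply/eqP; rewrite eq_le pZ//=.
  have := pZ t^-1 (t *: v); rewrite invr_gt0 => /(_ t0).
  by rewrite scalerA mulVf ?gt_eqF// scale1r -ler_pdivlMl.
apply/pP; rewrite scalerDl addrACA.
by apply: CD; exact: gauge_mem.
Qed.

Lemma gauge_unit : p e = -1.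
Proof. by rewrite -[e]scale1r -[1 *: e]add0r gauge_shift gauge0 sub0r. Qed.

Lemma gauge_width_eq0 v : p v + p (- v) = 0 -> v = - p v *: e.
Proof.
move=> h; apply/eqP; rewrite scaleNr -subr_eq0 opprK; apply/eqP.
apply: pointed; first exact: gauge_mem.
by rewrite opprD -scaleNr; apply/pP; lra.
Qed.

(** The opposite of a Hahn-Banach functional below [p] touching it at [a]; the values [p e = -1] and
    [p (- e) = 1] force the normalization at [e]. *)
Lemma gauge_support a : p a = 0 -> exists f : V -> R,
  [/\ scalar f, f a = 0, f e = 1 & forall v, C v -> 0 <= f v].
Proof.
move=> pa; have [g [gL gp ga]] := hahn_banach_point a gauge_sublinear.
exists (fun v => - g v); split.
- by move=> t u v; rewrite gL; ring.
- by rewrite ga pa oppr0.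
- have := gp e; have := gp (- e); rewrite (sformN gL) gauge_unit.
  have := gauge_shift 0 (-1); rewrite add0r scaleN1r gauge0 => ->; lra.
- by move=> v /gaugeP; have := gp v; lra.
Qed.

(** In the plane of [b] and [c] the boundary consists of their two rays: two negative coefficients
    contradict pointedness, and any other pair of nonzero ones splits an extremal vector into
    non-proportional summands. *)
Lemma boundary_two_points b c (q r : R) :
  (forall s t : R, s *: b + t *: c = 0 -> s = 0 /\ t = 0) ->
  p b = 0 -> p c = 0 -> p (q *: b + r *: c) = 0 -> q * r = 0.
Proof.
have [C0 CD CZ] := cC.
move=> ind pb pc pd; set d := q *: b + r *: c in pd.
have Cb : C b by apply/gaugeP; rewrite pb.
have Cc : C c by apply/gaugeP; rewrite pc.
have Cd : C d by apply/gaugeP; rewrite pd.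
have [q0|q0|->] := ltgtP q 0; last by rewrite mul0r.
- have [r0|r0|->] := ltgtP r 0; last by rewrite mulr0.
  + have d0 : d = 0.
      apply: pointed => //; rewrite /d opprD -!scaleNr.
      by apply: CD; apply: CZ => //; lra.
    have [] := ind q r d0; nra.
  + have [_ /(_ d (- q *: b) Cd)] := extremeZ cC r0 (ext pc).
    case; [by apply: CZ => //; lra | by rewrite /d; vfield | move=> t t0 h].
    have [|] := ind q (r - t * r); last nra.
    by move: h; rewrite /d scalerBl addrA -scalerA => ->; rewrite subrr.
- have [r0|r0|->] := ltgtP r 0; last by rewrite mulr0.
  + have [_ /(_ d (- r *: c) Cd)] := extremeZ cC q0 (ext pb).
    case; [by apply: CZ => //; lra | by rewrite /d; vfield | move=> t t0 h].
    have [|] := ind (q - t * q) r; last nra.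
    by move: h; rewrite /d scalerBl addrAC -scalerA => ->; rewrite subrr.
  + have [_ /(_ (q *: b) (r *: c))] := ext pd.
    case; [by apply: CZ => //; lra | by apply: CZ => //; lra | by [] |].
    move=> t t0 h; have [|] := ind (q - t * q) (- t * r); last nra.
    by rewrite scalerBl h /d; vfield.
Qed.

(** Pulled back by [h], the supports [f] and [g] become multiples of the tangent forms at [ya] and
    [yb], so the identity [mink_four_null] descends to [C]. *)
Lemma null_lift_four_points n (h : 'Hom('rV[R]_n.+1, V)) (f g : V -> R)
    a b c ya yb yc (s q r : R) (d := s *: a + q *: b + r *: c) :
  (forall w, lorentz_cone R n w -> C (h w)) ->
  null_lift h ya a -> null_lift h yb b -> null_lift h yc c ->
  null_lift h (s *: ya + q *: yb + r *: yc) d ->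
  a != 0 -> b != 0 ->
  scalar f -> scalar g -> (forall v, C v -> 0 <= f v) ->
  (forall v, C v -> 0 <= g v) -> f a = 0 -> g b = 0 ->
  f d * g d = r ^+ 2 * (f c * g c).
Proof.
move=> hC [La na ha] [Lb nb hb] [Lc nc hc] [Ld nd hd] a0 b0 fL gL f0 g0 fa gb.
have hL (k : V -> R) : scalar k -> scalar (k \o h).
  by move=> kL t u v /=; rewrite linearP kL.
have ya0 : ya != 0 by apply: contra_neq a0 => y0; rewrite -ha y0 linear0.
have yb0 : yb != 0 by apply: contra_neq b0 => y0; rewrite -hb y0 linear0.
have [||l fE] := lorentz_support (hL _ fL) _ La ya0 na.
- by move=> u Lu; exact/f0/hC.
- by rewrite /= ha.
have [||m gE] := lorentz_support (hL _ gL) _ Lb yb0 nb.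
- by move=> u Lu; exact/g0/hC.
- by rewrite /= hb.
move: fE gE => /= fE gE; rewrite -hd -hc !fE !gE.
have := congr1 ( *%R (l * m)) (mink_four_null na nb nc nd); lra.
Qed.

(** * Conics inscribed in three-dimensional sections *)

Hypothesis lfp : LFP (square_cone R) C.

(** With [k3 a3] moved to the side of [d], this is a relation of two positive terms against two, to
    which [LFP_null_lift] applies; the lifts are then rescaled. *)
Lemma mixed_sign_null_lift a1 a2 a3 d (k1 k2 k3 : R) :
  d = k1 *: a1 + k2 *: a2 - k3 *: a3 ->
  indep3 a1 a2 a3 -> p a1 = 0 -> p a2 = 0 -> p a3 = 0 -> p d = 0 ->
  0 < k1 -> 0 < k2 -> 0 < k3 ->
  exists n (h : 'Hom('rV[R]_n.+1, V)) (y1 y2 y3 : 'rV[R]_n.+1),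
  [/\ null_lift h y1 a1, null_lift h y2 a2, null_lift h y3 a3,
      null_lift h (k1 *: y1 + k2 *: y2 - k3 *: y3) d
    & forall w, lorentz_cone R n w -> C (h w)].
Proof.
move=> dE ind p1 p2 p3 pd k10 k20 k30.
have unscale n (h : 'Hom('rV[R]_n.+1, V)) (k : R) (y : 'rV[R]_n.+1) x : 0 < k ->
    null_lift h y (k *: x) -> null_lift h (k^-1 *: y) x.
  move=> k0 /(null_liftZ (a := k^-1)); rewrite scalerA mulVf ?gt_eqF//.
  by rewrite scale1r invr_ge0 ltW//; exact.
have [|||||||n [h [y1 [y2 [y3 [y4 [[l1 l2 l3 l4] rel hC]]]]]]] :=
    @LFP_null_lift _ _ C (k1 *: a1) d (k2 *: a2) (k3 *: a3) cC.
- by rewrite dE; vfield.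
- move=> u v w E.
  have [|h1 h2 h3] := ind (u * k1 + v * k1) (v * k2 + w * k2) (- v * k3).
    by rewrite -[RHS]E dE; vfield.
  have v0 : v = 0 by apply: (mulIf (lt0r_neq0 k30)); lra.
  rewrite v0 in h1 h2 *; split => //.
    by apply: (mulIf (lt0r_neq0 k10)); lra.
  by apply: (mulIf (lt0r_neq0 k20)); lra.
- exact: extremeZ (ext p1).
- exact: ext.
- exact: extremeZ (ext p2).
- exact: extremeZ (ext p3).
- exact: lfp.
exists n, h, (k1^-1 *: y1), (k2^-1 *: y3), (k3^-1 *: y4).
split=> //; try exact: unscale.
by rewrite !scalerA !divff ?gt_eqF// !scale1r rel addrK.
Qed.

(* Of the eight sign patterns of the coefficients, those that are not two
   against two in [s a + q b + r c - d = 0] contradict pointedness or the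
   extremality of one of the points. *)
Lemma four_points a b c (s q r : R) (f g : V -> R)
    (d := s *: a + q *: b + r *: c) :
  indep3 a b c -> p a = 0 -> p b = 0 -> p c = 0 -> p d = 0 ->
  s != 0 -> q != 0 -> r != 0 ->
  scalar f -> scalar g -> (forall v, C v -> 0 <= f v) ->
  (forall v, C v -> 0 <= g v) -> f a = 0 -> g b = 0 ->
  f d * g d = r ^+ 2 * (f c * g c).
Proof.
move=> ind pa pb pc pd s0 q0 r0 fL gL f0 g0 fa gb.
have [C0 CD CZ] := cC.
have Ca : C a by apply/gaugeP; rewrite pa.
have Cb : C b by apply/gaugeP; rewrite pb.
have Cc : C c by apply/gaugeP; rewrite pc.
have Cd : C d by apply/gaugeP; rewrite pd.
have an0 : a != 0.
  apply/eqP => a0; have [|] := ind 1 0 0; last lra.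
  by rewrite a0; vfield.
have bn0 : b != 0.
  apply/eqP => b0; have [|] := ind 0 1 0; last lra.
  by rewrite b0; vfield.
have concl n (h : 'Hom('rV[R]_n.+1, V)) ya yb yc yd :
    (forall w, lorentz_cone R n w -> C (h w)) ->
    null_lift h ya a -> null_lift h yb b -> null_lift h yc c ->
    null_lift h yd d -> yd = s *: ya + q *: yb + r *: yc ->
    f d * g d = r ^+ 2 * (f c * g c).
  by move=> hC la lb lc ld ydE; rewrite ydE in ld;
    exact: (null_lift_four_points hC la lb lc ld).
move: s0 q0 r0; rewrite !neq_lt => /orP[s0|s0] /orP[q0|q0] /orP[r0|r0].
- have d0 : d = 0.
    apply: pointed => //; rewrite /d !opprD -!scaleNr.
    by apply: (CD); [apply: (CD)|]; apply: (CZ) => //; lra.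
  by have [] := ind s q r d0; lra.
- have [_ /(_ (- s *: a) (d - q *: b))] := extremeZ cC r0 (ext pc).
  case; [| | by rewrite /d; vfield | move=> t _ h].
  + by apply: CZ => //; lra.
  + by rewrite -scaleNr; apply: CD => //; apply: CZ => //; lra.
  have [|] := ind (- s) 0 (- t * r); last lra.
  by rewrite h; vfield.
- have [_ /(_ (- s *: a) (d - r *: c))] := extremeZ cC q0 (ext pb).
  case; [| | by rewrite /d; vfield | move=> t _ h].
  + by apply: CZ => //; lra.
  + by rewrite -scaleNr; apply: CD => //; apply: CZ => //; lra.
  have [|] := ind (- s) (- t * q) 0; last lra.
  by rewrite h; vfield.
- have ns0 : 0 < - s by rewrite oppr_gt0.
  have [|||||||||n [h [y1 [y2 [y3 [l1 l2 l3 ld hC]]]]]] :=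
      @mixed_sign_null_lift b c a d q r (- s) => //.
  + by rewrite /d; vfield.
  + by move=> x y z E; have [|] := ind z x y; [rewrite -[RHS]E; vfield|].
  by apply: (concl n h _ _ _ _ hC l3 l1 l2 ld); vfield.
- have [_ /(_ (- q *: b) (d - r *: c))] := extremeZ cC s0 (ext pa).
  case; [| | by rewrite /d; vfield | move=> t _ h].
  + by apply: CZ => //; lra.
  + by rewrite -scaleNr; apply: CD => //; apply: CZ => //; lra.
  have [|] := ind (- t * s) (- q) 0; last lra.
  by rewrite h; vfield.
- have nq0 : 0 < - q by rewrite oppr_gt0.
  have [|||||||||n [h [y1 [y2 [y3 [l1 l2 l3 ld hC]]]]]] :=
      @mixed_sign_null_lift a c b d s r (- q) => //.
  + by rewrite /d; vfield.
  + by move=> x y z E; have [|] := ind x z y; [rewrite -[RHS]E; vfield|].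
  by apply: (concl n h _ _ _ _ hC l1 l3 l2 ld); vfield.
- have nr0 : 0 < - r by rewrite oppr_gt0.
  have [|||||||||n [h [y1 [y2 [y3 [l1 l2 l3 ld hC]]]]]] :=
      @mixed_sign_null_lift a b c d s q (- r) => //.
  + by rewrite /d; vfield.
  by apply: (concl n h _ _ _ _ hC l1 l2 l3 ld); vfield.
- have [_ /(_ (s *: a) (q *: b + r *: c))] := ext pd.
  case; [| | by rewrite /d addrA | move=> t _ h].
  + by apply: CZ => //; lra.
  + by apply: CD; apply: CZ => //; lra.
  have [|h1 h2 _] := ind (s - t * s) (- t * q) (- t * r).
    by rewrite scalerBl h /d; vfield.
  have t0 : t = 0 by apply: (mulIf (lt0r_neq0 q0)); lra.
  by move: h1; rewrite t0; lra.
Qed.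

(* Once [C] is known to be bounded by a quadric, [p v] and [- p (- v)] are the
   two parameters at which the line [v + t e] meets it: [width] is half their
   distance and [time] the opposite of their midpoint. *)
Definition width v := (p v + p (- v)) / 2.
Definition time v := (p (- v) - p v) / 2.

Lemma gauge_memE v : C v <-> width v <= time v.
Proof. by rewrite gaugeP /width /time; split; lra. Qed.

Lemma width_ge0 v : 0 <= width v.
Proof. by have := sublinear_subN v gauge_sublinear; rewrite /width; lra. Qed.

Lemma width_eq0 v : width v = 0 -> v = - p v *: e.
Proof. by move=> w0; apply: gauge_width_eq0; rewrite /width in w0; lra. Qed.

Lemma width_shift v t : width (v + t *: e) = width v.
Proof.
rewrite /width; have -> : - (v + t *: e) = - v + (- t) *: e by vfield.
by rewrite !gauge_shift; field.
Qed.

Lemma time_shift v t : time (v + t *: e) = time v + t.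
Proof.
rewrite /time; have -> : - (v + t *: e) = - v + (- t) *: e by vfield.
by rewrite !gauge_shift; field.
Qed.

Lemma width_timeZ t v :
  width (t *: v) ^+ 2 = t ^+ 2 * width v ^+ 2 /\ time (t *: v) = t * time v.
Proof.
have [pZ _] := gauge_sublinear; rewrite /width /time.
have [t0|t0] := leP 0 t.
  by rewrite -scalerN !pZ//; split; field.
have nt0 : 0 <= - t by lra.
have -> : t *: v = - t *: - v by vfield.
have -> : - (- t *: - v) = - t *: v by vfield.
by rewrite !pZ//; split; field.
Qed.

Lemma width_time0 : width 0 = 0 /\ time 0 = 0.
Proof. by rewrite /width /time oppr0 gauge0; split; field. Qed.

(** [f] and [g] support [C] at the boundary points [a] and [b] over [x] and [- x]. The boundary
    satisfies [f g = t ^+ 2 * K]; intersecting with lines parallel to [e] gives [time = (f + g) / 2]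
    and [width ^+ 2 = ((g - f) / 2) ^+ 2 + t ^+ 2 * K]. *)
Lemma indep3_section x y : indep3 e x y -> exists k l : R, forall s t,
  time (s *: x + t *: y) = s * time x + t * time y /\
  width (s *: x + t *: y) ^+ 2 = (s * width x + t * k) ^+ 2 + t ^+ 2 * l.
Proof.
move=> ind.
pose a := x + p x *: e; pose b := - x + p (- x) *: e; pose c := y + p y *: e.
have pa : p a = 0 := gauge_boundary _.
have pb : p b = 0 := gauge_boundary _.
have pc : p c = 0 := gauge_boundary _.
have wx : p x + p (- x) != 0.
  apply/eqP => /gauge_width_eq0 xE; have [|] := ind (p x) 1 0; last lra.
  by rewrite {2}xE; vfield.
have indabc : indep3 a b c.
  move=> q r t E.
  have [|h1 h2 h3] := ind (q * p x + r * p (- x) + t * p y) (q - r) t.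
    by rewrite -[RHS]E /a /b /c; vfield.
  have q0 : q = 0 by apply: (mulIf wx); rewrite h3 in h1; nra.
  by split => //; lra.
have [f [fL fa fe f0]] := gauge_support pa.
have [g [gL gb ge g0]] := gauge_support pb.
have fx : f x = - p x.
  by move: fa; rewrite /a (sformD fL) (sformZ fL) fe; lra.
have gx : g x = p (- x).
  by move: gb; rewrite /b (sformD gL) (sformZ gL) (sformN gL) ge; lra.
pose K := f c * g c.
(* The boundary of the section by [<e, x, y>] lies on the conic of the pencil
   tangent at [a] and [b] that passes through [c]. *)
have key (u s t : R) : p (u *: e + s *: x + t *: y) = 0 ->
    f (u *: e + s *: x + t *: y) * g (u *: e + s *: x + t *: y) = t ^+ 2 * K.
  (* [al], [be] and [t] are the coordinates in the basis [a], [b], [c]. *)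
  pose al := (u + s * p (- x) - t * p y) / (p x + p (- x)); pose be := al - s.
  have -> : u *: e + s *: x + t *: y = al *: a + be *: b + t *: c.
    by rewrite /a /b /c /be /al; vfield.
  move=> pd.
  (* When a coefficient vanishes [four_points] does not apply, but then all cross terms of the
     expanded product are zero. *)
  have prod0 : al * be = 0 -> be * t = 0 -> al * t = 0 ->
    f (al *: a + be *: b + t *: c) * g (al *: a + be *: b + t *: c) = t ^+ 2 * K.
    clearbody a b c al be; move=> h1 h2 h3.
    rewrite !(sformD fL, sformD gL, sformZ fL, sformZ gL).
    rewrite fa gb /K.
    have := congr1 ( *%R^~ (f b * g a)) h1.
    have := congr1 ( *%R^~ (f b * g c)) h2.
    by have := congr1 ( *%R^~ (g a * f c)) h3; rewrite /=; lra.
  have [al0|al0] := eqVneq al 0.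
    apply: prod0; rewrite ?al0 ?mul0r//.
    apply: (@boundary_two_points b c) => //; last first.
      by move: pd; rewrite al0 scale0r add0r.
    move=> q r E; have [|] := indabc 0 q r; last by [].
    by rewrite scale0r add0r.
  have [be0|be0] := eqVneq be 0.
    apply: prod0; rewrite ?be0 ?mul0r ?mulr0//.
    apply: (@boundary_two_points a c) => //; last first.
      by move: pd; rewrite be0 scale0r addr0.
    move=> q r E; have [|] := indabc q 0 r; last by [].
    by rewrite scale0r addr0.
  have [t0|t0] := eqVneq t 0.
    apply: prod0; rewrite ?t0 ?mul0r ?mulr0//.
    apply: (@boundary_two_points a b) => //; last first.
      by move: pd; rewrite t0 scale0r addr0.
    move=> q r E; have [|] := indabc q r 0; last by [].
    by rewrite scale0r addr0.
  exact: (four_points indabc).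
have main s t (v := s *: x + t *: y) :
    f v + g v = p (- v) - p v /\
    (p v + p (- v)) ^+ 2 = (g v - f v) ^+ 2 + 4 * K * t ^+ 2.
  have [v0|v0] := eqVneq (p v + p (- v)) 0.
    have [|h1 h2 h3] := ind (p v) s t.
      by rewrite -addrA -/v {2}(gauge_width_eq0 v0); vfield.
    rewrite v0; have -> : v = 0 by rewrite /v h2 h3 !scale0r addr0.
    by rewrite oppr0 gauge0 (sform0 fL) (sform0 gL) h3; split; ring.
  (* The conic equation at the boundary points over [v] and [- v]; the difference of the two is
     divisible by [p v + p (- v)]. *)
  have := key (p v) s t; have := key (p (- v)) (- s) (- t).
  have -> : p (- v) *: e + - s *: x + - t *: y = - v + p (- v) *: e.
    by rewrite /v; vfield.
  have -> : p v *: e + s *: x + t *: y = v + p v *: e by rewrite /v; vfield.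
  rewrite !gauge_boundary => /(_ erefl) E2 /(_ erefl) E1.
  clearbody v; move: E1 E2.
  rewrite !(sformD fL, sformD gL, sformZ fL, sformZ gL, sformN fL,
            sformN gL) fe ge.
  move: (f v) (g v) (p v) (p (- v)) v0 => A B P N PN E1 E2.
  have AB : A + B = N - P by apply: (mulIf PN); lra.
  split=> //; have BE : B = N - P - A by lra.
  by rewrite BE in E1 *; lra.
have timeE s t (v := s *: x + t *: y) : time v = (f v + g v) / 2.
  by rewrite /time (main s t).1.
have timeyE : time y = (f y + g y) / 2.
  by have := timeE 0 1; rewrite scale0r add0r scale1r.
exists ((g y - f y) / 2), K => s t; split.
  rewrite timeE timeyE /time !(sformD fL, sformD gL, sformZ fL, sformZ gL).
  by rewrite fx gx; field.
rewrite /width exprMn (main s t).2.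
by rewrite !(sformD fL, sformD gL, sformZ fL, sformZ gL) fx gx; field.
Qed.

(** The formula survives when [e], [x], [y] are dependent: modulo [e], either [x] is zero or [y] is
    a multiple of [x]. *)
Lemma width_time_section x y : exists k l : R, forall s t,
  time (s *: x + t *: y) = s * time x + t * time y /\
  width (s *: x + t *: y) ^+ 2 = (s * width x + t * k) ^+ 2 + t ^+ 2 * l.
Proof.
have e0 : e != 0 by apply: contra_not_neq CNe => ->; rewrite oppr0; case: cC.
have [w0 t0] := width_time0.
have shift u t : width (t *: u) ^+ 2 = t ^+ 2 * width u ^+ 2 /\
                 time (t *: u) = t * time u := width_timeZ t u.
have [xe|xe] := pselect (exists m, x = m *: e).
  have [m xE] := xe; exists 0, (width y ^+ 2) => s t.
  have -> : s *: x + t *: y = t *: y + (s * m) *: e by rewrite xE; vfield.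
  have -> : width x = 0 by rewrite xE -[_ *: e]add0r width_shift.
  have -> : time x = m by rewrite xE -[_ *: e]add0r time_shift t0 add0r.
  by rewrite width_shift time_shift !(shift _ _).1 !(shift _ _).2; split; ring.
have [yx|yx] := pselect (exists m n, y = m *: x + n *: e).
  have [m [n yE]] := yx; exists (m * width x), 0 => s t.
  have -> : s *: x + t *: y = (s + t * m) *: x + (t * n) *: e.
    by rewrite yE; vfield.
  rewrite yE !width_shift !time_shift !(shift _ _).1 !(shift _ _).2.
  by split; ring.
apply: indep3_section => r s t E.
have [t00|tn0] := eqVneq t 0.
  have [s00|sn0] := eqVneq s 0.
    split=> //; apply/eqP; move/eqP: E.
    by rewrite t00 s00 !scale0r !addr0 scaler_eq0 (negbTE e0) orbF.
  case: xe; exists (- r / s); apply: (scalerI sn0).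
  rewrite -[LHS]subr0 -[in LHS]E t00; by vfield.
case: yx; exists (- s / t), (- r / t); apply: (scalerI tn0).
by rewrite -[LHS]subr0 -[in LHS]E; vfield.
Qed.

(** * Linearity of [time] and the bilinear form behind [width] *)

Lemma time_scalar : scalar time.
Proof.
move=> a u v; have [k [l h]] := width_time_section u v.
by have := (h a 1).1; rewrite scale1r mul1r.
Qed.

(** The polar form of the square of [width]. *)
Definition wform u v :=
  (width (u + v) ^+ 2 - width u ^+ 2 - width v ^+ 2) / 2.

Lemma width_comb u v (s t : R) : width (s *: u + t *: v) ^+ 2 =
  s ^+ 2 * width u ^+ 2 + 2 * s * t * wform u v + t ^+ 2 * width v ^+ 2.
Proof.
have [k [l h]] := width_time_section u v.
have := (h 1 1).2; have := (h 0 1).2.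
by rewrite !scale1r scale0r add0r (h s t).2 /wform => -> ->; field.
Qed.

Lemma wformC u v : wform u v = wform v u.
Proof. by rewrite /wform [v + u]addrC addrAC. Qed.

Lemma wform_width v : wform v v = width v ^+ 2.
Proof.
rewrite /wform; have -> : v + v = 2%:R *: v by vfield.
by rewrite (width_timeZ _ _).1; field.
Qed.

Lemma wformZl (a : R) u v : wform (a *: u) v = a * wform u v.
Proof.
rewrite {1}/wform; have := width_comb u v a 1; rewrite scale1r => ->.
by rewrite (width_timeZ _ _).1; field.
Qed.

(** The Jordan-von Neumann argument: the parallelogram law at [x + z] and [x - z] yields [mid],
    which is then applied to the half sum and half difference of [u] and [v]. *)
Lemma wformDl u v z : wform (u + v) z = wform u z + wform v z.
Proof.
have B4 x y : 4 * wform x y = width (x + y) ^+ 2 - width (x - y) ^+ 2.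
  have := width_comb x y 1 (-1); have := width_comb x y 1 1.
  by rewrite !scale1r scaleN1r => -> ->; ring.
have par x y : width (x + y) ^+ 2 + width (x - y) ^+ 2 =
    2 * width x ^+ 2 + 2 * width y ^+ 2.
  have := width_comb x y 1 (-1); have := width_comb x y 1 1.
  by rewrite !scale1r scaleN1r => -> ->; ring.
have mid x y : wform (x + y) z + wform (x - y) z = 2 * wform x z.
  have := par (x + z) y; have := par (x - z) y.
  have := B4 (x + y) z; have := B4 (x - y) z; have := B4 x z.
  rewrite (addrAC x y z) (addrAC x y (- z)).
  by rewrite (addrAC x (- y) z) (addrAC x (- y) (- z)); lra.
have := mid (2^-1 *: (u + v)) (2^-1 *: (u - v)).
have -> : 2^-1 *: (u + v) + 2^-1 *: (u - v) = u by vfield.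
have -> : 2^-1 *: (u + v) - 2^-1 *: (u - v) = v by vfield.
by rewrite wformZl => ->; field.
Qed.

Lemma wform_scalar z : scalar (wform^~ z).
Proof. by move=> a u v; rewrite wformDl wformZl. Qed.

Lemma wform_unit v : wform e v = 0.
Proof.
have ev : width (e + v) = width v.
  by rewrite addrC -[X in v + X]scale1r width_shift.
have e0 : width e = 0.
  by rewrite -[e]scale1r -[1 *: e]add0r width_shift width_time0.1.
by rewrite /wform ev e0; ring.
Qed.

(** * Orthonormal coordinates and the isomorphism with a Lorentz cone *)

Lemma orthonormal_family k : (k < \dim {:V})%N -> exists s : nat -> V,
  (forall i, (i < k)%N -> time (s i) = 0) /\
  (forall i j, (i < k)%N -> (j < k)%N -> wform (s i) (s j) = (i == j)%:R).
Proof.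
elim: k => [|k IH] kV; first by exists (fun=> 0); split.
have [s [s0 sB]] := IH (ltnW kV).
(* Gram-Schmidt within [time = 0]. The line of [e] takes one dimension, so [U] has dimension at most
   [k + 1] and is not the whole space. *)
pose U := (<[e]> + <<[seq s i | i <- iota 0 k]>>)%VS.
have [v vU] : exists v, v \notin U.
  apply: contrapT => nv; suff : (\dim {:V} <= k.+1)%N by rewrite leqNgt kV.
  have /dimvS/leq_trans -> // : (fullv <= U)%VS.
    by apply/subvP => v _; apply/negPn/negP => vU; apply: nv; exists v.
  apply: leq_trans (dimv_add_leqif _ _).1 _; rewrite dim_vline -add1n leq_add//.
    by case: (e != 0).
  by apply: leq_trans (dim_span _) _; rewrite size_map size_iota.
pose x := v - time v *: e - \sum_(i < k) wform v (s i) *: s i.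
have timeS (c : nat -> R) : time (\sum_(i < k) c i *: s i) = 0.
  rewrite (big_morph time (sformD time_scalar) (sform0 time_scalar)).
  by rewrite big1// => i _; rewrite (sformZ time_scalar) s0 ?mulr0.
have xt : time x = 0.
  rewrite /x !(sformD time_scalar, sformN time_scalar).
  rewrite (timeS (fun i => wform v (s i))).
  by rewrite -[_ *: e]add0r time_shift width_time0.2; ring.
have xs j : (j < k)%N -> wform x (s j) = 0.
  move=> jk; have wL := wform_scalar (s j).
  rewrite /x !(sformD wL, sformN wL, sformZ wL) wform_unit.
  rewrite (big_morph (wform^~ (s j)) (sformD wL) (sform0 wL)).
  rewrite (bigD1 (Ordinal jk))//= big1 => [|i ij]; last first.
    by rewrite (sformZ wL) sB// (_ : (i == j :> nat) = false) ?mulr0//; apply/negbTE.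
  rewrite (sformZ wL) sB// eqxx.
  have -> : true%:R = 1 :> R by [].
  by ring.
(* A zero width would make [x] a multiple of [e], placing [v] in [U]. *)
have xw : width x != 0.
  apply: contra vU => /eqP/width_eq0 xE.
  have -> : v = (time v - p x) *: e + \sum_(i < k) wform v (s i) *: s i.
    by rewrite scalerBl -scaleNr -xE /x; move: (\sum_(i < k) _) => S; vfield.
  apply: memv_add; first by rewrite memvZ// memv_line.
  apply: memv_suml => i _; apply/memvZ/memv_span/map_f.
  by rewrite mem_iota /= add0n.
pose y := (width x)^-1 *: x.
have yy : wform y y = 1.
  by rewrite wformZl wformC wformZl wform_width; field.
have yk l : (l < k)%N -> wform y (s l) = 0.
  by move=> lk; rewrite wformZl xs// mulr0.
have ltk l : (l < k.+1)%N -> l = k \/ (l < k)%N.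
  by rewrite ltnS leq_eqVlt => /orP[/eqP->|]; [left | right].
exists (fun i => if (i < k)%N then s i else y); split=> [i /ltk[->|ik]|i j].
- by rewrite ltnn (sformZ time_scalar) xt mulr0.
- by rewrite ik s0.
move=> /ltk[->|ik] /ltk[->|jk]; rewrite ?ltnn ?ik ?jk.
- by rewrite eqxx yy.
- by rewrite yk// gtn_eqF.
- by rewrite wformC yk// ltn_eqF.
- exact: sB.
Qed.

(** In the coordinates given by [e] and an orthonormal family, [time] is the first coordinate and
    [width] the Euclidean norm of the others, so [width <= time] is the Lorentz inequality. *)
Lemma gauge_lorentzian : (0 < \dim {:V})%N -> lorentzian C.
Proof.
move=> dimV; pose n := (\dim {:V}).-1; have nV : n.+1 = \dim {:V} by rewrite prednK.
have [s [s0 sB]] := @orthonormal_family n (eq_leq nV).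
pose F (v : 'rV[R]_n.+1) := v 0 ord0 *: e + \sum_(i < n) v 0 (lift ord0 i) *: s i.
have FL : linear F.
  move=> a u v; rewrite /F !mxE scalerDr scaler_sumr addrACA -big_split /=.
  rewrite scalerA -scalerDl; congr (_ + _); apply: eq_bigr => i _.
  by rewrite !mxE; vfield.
pose F' : {linear 'rV[R]_n.+1 -> V} :=
  HB.pack F (GRing.isLinear.Build R 'rV[R]_n.+1 V _ F FL).
pose f := linfun F'; have fE (v : 'rV[R]_n.+1) : f v = F v by rewrite lfunE.
have timef (v : 'rV[R]_n.+1) : time (f v) = v 0 ord0.
  rewrite fE /F addrC time_shift.
  rewrite (big_morph time (sformD time_scalar) (sform0 time_scalar)).
  by rewrite big1 ?add0r// => i _; rewrite (sformZ time_scalar) s0 ?mulr0.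
have widthf (v : 'rV[R]_n.+1) : width (f v) ^+ 2 = \sum_(i < n) v 0 (lift ord0 i) ^+ 2.
  rewrite fE /F addrC width_shift -wform_width.
  set S := \sum_(i < n) _ *: _.
  have wS z : wform S z = \sum_(i < n) v 0 (lift ord0 i) * wform (s i) z.
    have wL := wform_scalar z.
    rewrite (big_morph (wform^~ z) (sformD wL) (sform0 wL)).
    by apply: eq_bigr => i _; rewrite (sformZ wL).
  rewrite wS; apply: eq_bigr => i _; rewrite wformC wS (bigD1 i)//= big1.
    rewrite sB// eqxx; have -> : true%:R = 1 :> R by [].
    by ring.
  move=> j ji; rewrite sB// (_ : (j == i :> nat) = false) ?mulr0//.
  exact/negbTE.
have fC (v : 'rV[R]_n.+1) : C (f v) <-> lorentz_cone R n v.
  rewrite gauge_memE timef /lorentz_cone /= -widthf sqrtr_sqr.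
  by rewrite ger0_norm ?width_ge0.
have finj : lker f == 0%VS.
  apply/lker0P => u v uv; apply/subr0_eq.
  have : f (u - v) = 0 by rewrite linearB /= uv subrr.
  move: (u - v) => z z0; apply/rowP => j; rewrite [RHS]mxE.
  have [w0 t0] := width_time0.
  case: (unliftP ord0 j) => [i ->|->]; last by rewrite -timef z0 t0.
  have /eqP := widthf z; rewrite z0 w0 expr0n /= eq_sym psumr_eq0 => [|l _].
    by move/allP => /(_ i); rewrite mem_index_enum sqrf_eq0 => /(_ isT)/eqP.
  exact: sqr_ge0.
(* Injectivity and equality of dimensions give surjectivity. *)
have fsurj v : f (f^-1%VF v) = v.
  apply: limg_lfunVK; suff -> : limg f = fullv by exact: memvf.
  have dimf : \dim (limg f) = n.+1.
    by rewrite limg_dim_eq ?(eqP finj) ?capv0// dimvf /dim /= mul1n.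
  by apply/eqP; rewrite -(geq_leqif (dimv_leqif_eq (subvf _))) dimf nV.
exists n, f; split.
  by exists f^-1%VF => // v; exact: lker0_lfunK.
apply/seteqP; split=> [_ [v Lv <-]|v Cv]; first exact/fC.
by exists (f^-1%VF v) => //; apply/fC; rewrite fsurj.
Qed.

End Gauge.

Theorem theorem4 (R : realType) (V : vectType R) (hV : (0 < \dim {:V})%N)
  (C : set V) (hC : strictly_convex_cone C) (hLFP : LFP (square_cone R) C) :
  lorentzian C.
Proof.
have [pC rays] := hC; have [cC _ pt _] := pC.
have [e [Ce CNe unit]] := proper_cone_order_unit hV pC.
have [p pP] := proper_cone_gauge pC Ce CNe unit.
have pointed x : C x -> C (- x) -> x = 0.
  move=> Cx CNx; have : (C `&` [set - x | x in C]) x.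
    by split => //; exists (- x) => //; rewrite opprK.
  by rewrite pt.
have extr v : p v = 0 -> extreme C v.
  move=> pv; have Cv : C v by rewrite (gaugeP pP) pv.
  (* Strict convexity speaks of nonzero boundary points only; at [v = 0] pointedness gives
     [y = 0]. *)
  split => // y z Cy Cz vE; have [v0|vn0] := eqVneq v 0.
    exists 0 => //; rewrite scale0r; apply: pointed => //.
    by have /eqP := vE; rewrite v0 eq_sym addr_eq0 => /eqP ->; rewrite opprK.
  have [[_ _ fv] _] := rays v (gauge0_boundary Ce cC pP pv) vn0.
  have rv : ray v v by exists 1; rewrite /= ?ler01// scale1r.
  by have [[t /= t0 <-] _] := fv _ _ _ rv Cy Cz vE; exists t.
exact: (gauge_lorentzian cC pointed CNe pP extr hLFP hV).
Qed.
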